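(* Let $X$ be a Hausdorff topological vector space over $\mathbb{R}$ or $\mathbb{C}$, $A\subset X$ a convex set, $H$ a nonempty set of functions $X\to\overline{\mathbb{R}}$ closed under vertical shifts (i.e. $h+c\in H$ for all $h\in H$, $c\in\mathbb{R}$), and $f_i\colon X\to\mathbb{R}$, $i\in I_0=\{0\}\cup I$, $I=\{1,\ldots,n\}$. Let the functions $f_i$, $i\in I_0$, be weakly $H$-codifferentiable at a point $x^*\in A$, and suppose that $H$ is closed under addition and that $0\in\operatorname{int}\operatorname{dom}h$ for every $h\in H$. Suppose that $x^*$ is a point of local maximum of the problem $$f_0(x)\to\sup,\quad x\in A,\quad f_i(x)\ge0,\quad i\in I.$$ Then for any $(\Phi_i,\Psi_i)\in\delta(f_i)_H[x^*]$ and $h_i\in\underline{\partial}_H\Phi_i(0)$, $i\in I_0$, such that the $H$-concave function $$g(\cdot)=\inf\{h_0(\cdot)+\Psi_0(\cdot),\ h_1(\cdot)+\Psi_1(\cdot)+f_1(x^* ),\ldots,h_n(\cdot)+\Psi_n(\cdot)+f_n(x^* )\}$$ is superhomogeneous, the function $g$ has a global maximum value on the set $A-x^*$ at the origin.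
   Context: $\overline{\mathbb{R}}=\mathbb{R}\cup\{\pm\infty\}$ with $x+(\pm\infty)=\pm\infty$ for real $x$; expressions $+\infty+(-\infty)$ are not considered, i.e. all sums appearing are understood to be well defined. For $f\colon X\to\overline{\mathbb{R}}$, $\operatorname{dom}f=\{x: f(x)\in\mathbb{R}\}$. $H$ is closed under addition if for any $h_1,h_2\in H$ the sum $h_1+h_2$ is well defined and belongs to $H$. A function $X\to\overline{\mathbb{R}}$ is $H$-convex (resp. $H$-concave) if it is the pointwise supremum (resp. infimum) of a nonempty subset of $H$. $A-x^*=\{a-x^*\mid a\in A\}$. A function $f\colon X\to\mathbb{R}$ is weakly $H$-codifferentiable at $x$ if there is a pair $(\Phi,\Psi)$, with $\Phi\colon X\to\overline{\mathbb{R}}$ $H$-convex, $\Psi\colon X\to\overline{\mathbb{R}}$ $H$-concave and $\operatorname{dom}\Phi\cap\operatorname{dom}\Psi$ containing a neighbourhood of $0$, such that $\Phi(0)+\Psi(0)=0$ and for every $\Delta x\in X$ with $\operatorname{co}\{0,\Delta x\}\subset\operatorname{dom}\Phi\cap\operatorname{dom}\Psi$ one has $f(x+\Delta x)-f(x)=\Phi(\Delta x)+\Psi(\Delta x)+o(\Delta x,x)$, where $o(\alpha\Delta x,x)/\alpha\to0$ as $\alpha\downarrow0$. The weak $H$-derivative $\delta f_H[x]$ is the set (equivalence class) of all such pairs. $\underline{\partial}_H\Phi(0)=\{h\in H\mid h\le\Phi\text{ on }X,\ h(0)=\Phi(0)\}$ is the $H$-subdifferential of $\Phi$ at $0$. A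 function $f\colon X\to\overline{\mathbb{R}}$ with $f(0)=0$ is superhomogeneous if $f(\alpha\Delta x)\ge\alpha f(\Delta x)$ for all $\Delta x\in X$, $\alpha\in(0,1)$. *)

(* Defs.v *)
From mathcomp Require Import all_boot all_order all_algebra.
From mathcomp Require Import all_classical all_reals all_analysis.
From mathcomp.real_closed Require Import complex.

Set Implicit Arguments.
Unset Strict Implicit.
Unset Printing Implicit Defensive.

Import Order.TTheory GRing.Theory Num.Theory.
Import numFieldNormedType.Exports.

Local Open Scope classical_set_scope.
Local Open Scope ring_scope.

(* The two possible fields of scalars of the topological vector space. *)
Variant scalar_kind := RealScalars | ComplexScalars.

Definition scalar_field (R : realType) (k : scalar_kind) : numFieldType :=
  match k with
  | RealScalars => R : numFieldType
  | ComplexScalars => R[i] : numFieldType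
  end.

Definition of_real (R : realType) (k : scalar_kind) : R -> scalar_field R k :=
  match k with
  | RealScalars => fun a => a
  | ComplexScalars => fun a => (a%:C)%C
  end.

Section HConvexity.
Context (R : realType) (k : scalar_kind) (X : topologicalLmodType (scalar_field R k)).
Implicit Types (H : set (X -> \bar R)) (A : set X) (f : X -> \bar R).

Local Notation "a *:r x" := (of_real k a *: x) (at level 40).

Definition edom f : set X := [set x | f x \is a fin_num].

Definition shift_closed H :=
  forall h (c : R), H h -> H (fun x => h x + c%:E)%E.

(* The library's total addition sets [+oo + -oo = -oo]; [x +? y] excludes
   this undefined case. *)
Definition well_defined_sum f1 f2 := forall x, (f1 x +? f2 x)%E.

Definition add_closed H := forall h1 h2, H h1 -> H h2 ->
  well_defined_sum h1 h2 /\ H (fun x => h1 x + h2 x)%E.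

Definition Hconvex H f := exists U : set (X -> \bar R),
  [/\ U !=set0, U `<=` H & forall x, f x = ereal_sup [set h x | h in U]].

Definition Hconcave H f := exists U : set (X -> \bar R),
  [/\ U !=set0, U `<=` H & forall x, f x = ereal_inf [set h x | h in U]].

(* [convex_set] quantifies over the scalars [t] with [0 <= t <= 1]; for complex
   scalars the order of [R[i]] forces such [t] to be real, so that this is
   convexity in the usual sense. *)
Definition convex_hull A : set X :=
  smallest (@convex_set (scalar_field R k) X) A.

Definition weak_Hderivative H (f : X -> R) (x : X) :
    set ((X -> \bar R) * (X -> \bar R)) :=
  [set P | let: (Phi, Psi) := P in
    let D := edom Phi `&` edom Psi in
    [/\ Hconvex H Phi, Hconcave H Psi, nbhs (0 : X) D,
        (Phi 0%R + Psi 0%R = 0)%E &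
        exists o : X -> R, forall dx, convex_hull [set 0; dx] `<=` D ->
          (f (x + dx) - f x)%:E = (Phi dx + Psi dx + (o dx)%:E)%E /\
          o (a *:r dx) / a @[a --> (0 : R)^'+] --> (0 : R)]].

Definition weakly_Hcodifferentiable H (f : X -> R) (x : X) :=
  weak_Hderivative H f x !=set0.

Definition Hsubdifferential0 H f : set (X -> \bar R) :=
  [set h | [/\ H h, (forall x, (h x <= f x)%E) & h 0 = f 0]].

Definition superhomogeneous f := f 0 = 0%E /\
  forall dx (a : R), 0 < a < 1 -> (a%:E * f dx <= f (a *:r dx))%E.

(* The index [ord0] is the objective, [lift ord0 i] the [i]-th constraint. *)
Definition feasible n A (f : 'I_n.+1 -> X -> R) : set X :=
  [set x | A x /\ forall i : 'I_n, 0 <= f (lift ord0 i) x].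

Definition local_max_on (S : set X) (F : X -> R) (x : X) :=
  S x /\ \forall y \near x, S y -> F y <= F x.

Definition global_max_on (S : set X) f (x : X) :=
  S x /\ forall y, S y -> (f y <= f x)%E.

Definition translate_sub A (x : X) : set X := [set a - x | a in A].

Definition inf_model n (f : 'I_n.+1 -> X -> R) (xs : X)
    (h Psi : 'I_n.+1 -> X -> \bar R) (dx : X) : \bar R :=
  ereal_inf ([set (h ord0 dx + Psi ord0 dx)%E] `|`
    range (fun i : 'I_n => h (lift ord0 i) dx + Psi (lift ord0 i) dx
                           + (f (lift ord0 i) xs)%:E)%E).

End HConvexity.

(* Main.v *)
(* Suppose g(d) > 0 = g(0) for some d in A - xs. Superhomogeneity gives
   g(a d) >= a c for small a > 0 and some real c > 0. Since h_i <= Phi_i, the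
   codifferential expansion of f_i along d has error o(a), which a c absorbs:
   f_i(xs + a d) > 0 for each constraint and f_0(xs + a d) > f_0(xs). As A is
   convex, xs + a d is then a feasible point arbitrarily close to xs with a
   larger objective. The value g(d) = +oo is allowed, whence the real c, and d
   is first shrunk so that the segment [0, d] lies in all the domains. *)
Require Import Defs.
From mathcomp Require Import all_boot all_order all_algebra.
From mathcomp Require Import all_classical all_reals all_analysis.
From mathcomp.real_closed Require Import complex.
From mathcomp Require Import lra.

Set Implicit Arguments.
Unset Strict Implicit.
Unset Printing Implicit Defensive.

Import Order.TTheory GRing.Theory Num.Theory.
Import numFieldNormedType.Exports.

Local Open Scope classical_set_scope.
Local Open Scope ring_scope.

Lemma of_realM (R : realType) (k : scalar_kind) (a b : R) :
  of_real k (a * b) = of_real k a * of_real k b.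
Proof. by case: k => //=; rewrite rmorphM. Qed.

Lemma of_real_ge0 (R : realType) (k : scalar_kind) (a : R) :
  0 <= a -> 0 <= of_real k a.
Proof. by case: k => //= a0; rewrite -[0]/(0%:C)%C lecR. Qed.

Lemma of_real_le1 (R : realType) (k : scalar_kind) (a : R) :
  a <= 1 -> of_real k a <= 1.
Proof. by case: k => //= a0; rewrite -[1]/(1%:C)%C lecR. Qed.

(** For complex scalars, [0 < e] forces the imaginary part of [e] to vanish, so its real part serves
    as the witness. *)
Lemma exists_of_real_le (R : realType) (k : scalar_kind) (e : scalar_field R k) :
  0 < e -> exists2 a : R, 0 < a & of_real k a <= e.
Proof.
case: k e => /= e e0; first by exists e.
case: e e0 => a b; rewrite ltcE/= => /andP[/eqP-> a0].
by exists a => //; rewrite lecE/= eqxx lexx.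
Qed.

Section Lmodule.
Context (R : realType) (k : scalar_kind)
  (X : topologicalLmodType (scalar_field R k)).

Lemma conv_setP (A : set X) (x y : X) (t : scalar_field R k) :
  @convex_set (scalar_field R k) X A -> 0 <= t -> t <= 1 -> A x -> A y ->
  A (t *: x + (1 - t) *: y).
Proof.
move=> cA t0 t1 Ax Ay.
have := cA x y (Itv01 t0 t1); rewrite !inE; exact.
Qed.

(** The multiples of [d] by scalars in [0, 1] form a convex set containing 0 and [d], hence contain
    the hull. *)
Lemma convex_hull_segment (d x : X) : convex_hull [set 0; d] x ->
  exists t : scalar_field R k, [/\ 0 <= t, t <= 1 & x = t *: d].
Proof.
apply: (@smallest_sub _ (@convex_set (scalar_field R k) X) [set 0; d]
  [set x | exists t : scalar_field R k, [/\ 0 <= t, t <= 1 & x = t *: d]]).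
  move=> y z l; rewrite !inE/= => -[t [t0 t1 ->]] [s [s0 s1 ->]].
  have l0 : 0 <= l%:num by exact: ge0.
  have l1 : l%:num <= 1 by exact: le1.
  exists (l%:num * t + (1 - l%:num) * s); split.
  - by rewrite addr_ge0// mulr_ge0// subr_ge0.
  - apply: (@le_trans _ _ (l%:num * 1 + (1 - l%:num) * 1)).
      by rewrite lerD// ler_wpM2l// subr_ge0.
    by rewrite !mulr1 subrKC.
  - by rewrite scalerDl -!scalerA.
move=> y [->|->].
- by exists 0; rewrite scale0r.
- by exists 1; rewrite scale1r.
Qed.

(** Scaling is continuous at [(0, d)], so [D] contains [u *: d] for all scalars [u] in some ball
    around 0; multiplying [a] by [t] in [0, 1] does not leave that ball. *)
Lemma nbhs0_absorbing_segment (D : set X) (d : X) : nbhs 0 D ->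
  exists2 e : R, 0 < e & forall a : R, 0 <= a -> a <= e ->
  forall t : scalar_field R k, 0 <= t -> t <= 1 -> D (t *: (of_real k a *: d)).
Proof.
move=> D0.
have : nbhs ((0 : (scalar_field R k)^o) *: d) D by rewrite scale0r.
move=> /(@scale_continuous _ X (0, d))[[V W]/= [/nbhs_ballP[e /= e0 eV] Wd] VWD].
have eD t : ball (0 : (scalar_field R k)^o) e t -> D (t *: d).
  by move=> /eV Vt; apply: (VWD (t, d)); split => //; exact: nbhs_singleton Wd.
have [a a0 ae] := exists_of_real_le e0.
(* The ball is open: halving turns [b <= a / 2] into the strict [b < a]. *)
exists (a / 2); first by rewrite divr_gt0.
move=> b b0 ba t t0 t1; rewrite scalerA.
apply: eD; rewrite /ball/= sub0r normrN ger0_norm; last first.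
  by rewrite mulr_ge0// of_real_ge0.
apply: (@le_lt_trans _ _ (of_real k b)).
  by rewrite ler_piMl// of_real_ge0.
apply: lt_le_trans ae.
have : b < a by lra.
by case: (k) => //= ?; rewrite ltcR.
Qed.

End Lmodule.

Section Codifferential.
Context (R : realType) (k : scalar_kind)
  (X : topologicalLmodType (scalar_field R k)).

(** From [h <= P], the increment of [F] plus [b] is at least [a * c] plus the remainder, and the
    remainder is eventually smaller than [a * c] in absolute value. The constant [b] will be 0 for
    the objective and the value at the base point for a constraint. *)
Lemma weak_Hderivative_gt (H : set (X -> \bar R)) (F : X -> R) (x d : X)
    (P Q h : X -> \bar R) (c : R) :
  weak_Hderivative H F x (P, Q) -> (forall y, (h y <= P y)%E) ->
  (forall t : scalar_field R k, 0 <= t -> t <= 1 ->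
    (edom P `&` edom Q) (t *: d)) -> 0 < c ->
  \forall a \near 0^'+, forall b : R,
    ((a * c)%:E <= h (of_real k a *: d)%R + Q (of_real k a *: d)%R + b%:E)%E ->
    0 < F (x + of_real k a *: d) - F x + b.
Proof.
move=> [_ _ _ _ [rem remP]] hP dD c0.
have [|_ rem0] := remP d.
  by move=> _ /convex_hull_segment[t [t0 t1 ->]]; exact: dD.
have oc : \forall a \near 0^'+, `|rem (of_real k a *: d) / a| < c.
  by move/cvgr0Pnorm_lt : rem0; exact.
near=> a => b hb.
have a0 : 0 < a by near: a; exact: nbhs_right_gt.
have a1 : a <= 1 by near: a; exact: nbhs_right_le.
have [|FE _] := remP (of_real k a *: d).
  move=> _ /convex_hull_segment[t [t0 t1 ->]]; rewrite scalerA; apply: dD.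
    by rewrite mulr_ge0// of_real_ge0// ltW.
  by rewrite mulr_ile1// ?of_real_ge0 ?of_real_le1// ltW.
have oa : `|rem (of_real k a *: d)| < a * c.
  have : `|rem (of_real k a *: d) / a| < c by near: a.
  by rewrite normrM normfV (gtr0_norm a0) ltr_pdivrMr// mulrC.
(* The point lies in both domains, so [P] and [Q] are finite there and the comparison reduces to
   real numbers. *)
have [/=] := dD (of_real k a) (of_real_ge0 k (ltW a0)) (of_real_le1 k a1).
move: FE hb (hP (of_real k a *: d)).
rewrite /edom/=.
case: (P _) => [p| |]//; case: (Q _) => [q| |]//.
rewrite -!EFinD => -[->] hb hp _ _.
have := le_trans hb (leeD2r b%:E (leeD2r q%:E hp)).
rewrite -!EFinD lee_fin.
move: oa; rewrite ltr_norml => /andP[oa _] ac.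
lra.
Unshelve. all: by end_near.
Qed.

End Codifferential.

Theorem theorem5p6 (R : realType) (k : scalar_kind)
  (X : topologicalLmodType (scalar_field R k)) (hX : hausdorff_space X)
  (A : set X) (hA : @convex_set (scalar_field R k) X A)
  (H : set (X -> \bar R)) (H_nonempty : H !=set0) (H_shift : shift_closed H)
  (n : nat) (f : 'I_n.+1 -> X -> R) (xs : X) (xsA : A xs)
  (f_codiff : forall i, weakly_Hcodifferentiable H (f i) xs)
  (H_add : add_closed H)
  (H_dom : forall h, H h -> (edom h)° 0)
  (xs_max : local_max_on (feasible A f) (f ord0) xs)
  (Phi Psi : 'I_n.+1 -> X -> \bar R)
  (PhiPsi : forall i, weak_Hderivative H (f i) xs (Phi i, Psi i))
  (h : 'I_n.+1 -> X -> \bar R)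
  (h_sub : forall i, Hsubdifferential0 H (Phi i) (h i))
  (h_sum : forall i, well_defined_sum (h i) (Psi i))
  (g_superhom : superhomogeneous (inf_model f xs h Psi)) :
  global_max_on (translate_sub A xs) (inf_model f xs h Psi) 0.
Proof.
case: g_superhom => g0 gsup; split; first by exists xs => //; rewrite subrr.
move=> _ [y Ay <-]; rewrite g0 leNgt; apply/negP => gd.
set d := y - xs in gd.
have segA (t : scalar_field R k) : 0 <= t -> t <= 1 -> A (xs + t *: d).
  move=> t0 t1; have := conv_setP hA t0 t1 Ay xsA.
  by rewrite scalerBl scale1r addrCA -scalerBr.
have [c c0 cg] : exists2 c : R, 0 < c & (c%:E <= inf_model f xs h Psi d)%E.
  move: gd; case: (inf_model _ _ _ _ _) => [r| |]//.
    by rewrite lte_fin => r0; exists r.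
  by move=> _; exists 1 => //; rewrite leey.
have D0 : nbhs (0 : X)
    [set x | forall i, (edom (Phi i) `&` edom (Psi i)) x].
  by apply: filter_forall => i; have [] := PhiPsi i.
have [e e0 eD] := nbhs0_absorbing_segment d D0.
(* [s <= e] puts the segment from 0 to [s d] inside all the domains; [s < 1] helps keep [a * s] in
   the open interval where superhomogeneity applies. *)
pose s := Num.min e (1 / 2).
have s0 : 0 < s by rewrite lt_min e0 divr_gt0.
have s1 : s < 1 by rewrite gt_min ltr_pdivrMr// mul1r ltr1n orbT.
have se : s <= e by rewrite ge_min lexx.
case: xs_max => _ xs_max.
have U0 : nbhs (0 : X)
    [set x | feasible A f (xs + x) -> f ord0 (xs + x) <= f ord0 xs].
  move: xs_max; rewrite /prop_near1 -{1}[xs]addr0.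
  move=> /(@add_continuous X (xs, 0))[[V W]/= [Vxs W0] VW].
  apply: filterS W0 => x Wx; apply: (VW (xs, x)).
  by split => //; exact: nbhs_singleton Vxs.
have [r r0 rU] := nbhs0_absorbing_segment (of_real k s *: d) U0.
(* The direction is now [s d], so the growth rate is [s * c]; finitely many indices allow one range
   of [a] for all of them. *)
have gt0 : \forall a \near 0^'+, forall i, forall b : R,
    ((a * (s * c))%:E <= h i (of_real k a *: (of_real k s *: d))%R
      + Psi i (of_real k a *: (of_real k s *: d))%R + b%:E)%E ->
    0 < f i (xs + of_real k a *: (of_real k s *: d)) - f i xs + b.
  apply: filter_forall => i; apply: (weak_Hderivative_gt (PhiPsi i)).
  - by have [] := h_sub i.
  - by move=> t t0 t1; exact: (eD s (ltW s0) se t t0 t1).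
  - exact: mulr_gt0.
near (0 : R)^'+ => a.
have a0 : 0 < a by near: a; exact: nbhs_right_gt.
have a1 : a < 1 by near: a; exact: nbhs_right_lt.
have ar : a <= r by near: a; exact: nbhs_right_le.
have as0 : 0 < a * s by exact: mulr_gt0.
have as1 : a * s < 1 by rewrite mulr_ilt1// ltW.
have gta : forall i, forall b : R,
    ((a * (s * c))%:E <= h i (of_real k a *: (of_real k s *: d))%R
      + Psi i (of_real k a *: (of_real k s *: d))%R + b%:E)%E ->
    0 < f i (xs + of_real k a *: (of_real k s *: d)) - f i xs + b.
  by near: a.
move: gta; rewrite scalerA -of_realM mulrA => gta.
(* Superhomogeneity with factor [a * s], applied to the unshrunk [d]. *)
have gle : ((a * s * c)%:E <= inf_model f xs h Psi (of_real k (a * s) *: d))%E.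
  apply: le_trans (gsup d (a * s) _); last by rewrite as0.
  by rewrite EFinM lee_pmul2l// lte_fin.
(* Here [b = 0], since the objective enters the infimum without a constant. *)
have f0 : f ord0 xs < f ord0 (xs + of_real k (a * s) *: d).
  rewrite -subr_gt0 -[X in _ < X]addr0; apply: gta; rewrite adde0.
  by apply: (le_trans gle); apply: ereal_inf_lbound; left.
have feas : feasible A f (xs + of_real k (a * s) *: d).
  split; first by apply: segA; [exact/of_real_ge0/ltW|exact/of_real_le1/ltW].
  move=> i; apply/ltW.
  (* Here [b] is the constraint value at [xs], which cancels the subtracted one. *)
  rewrite -[X in _ < X](subrK (f (lift ord0 i) xs)).
  apply: gta; apply: (le_trans gle); apply: ereal_inf_lbound; right.
  by exists i.
(* At [t = 1] the segment gives its endpoint, the feasible point contradicting local maximality. *)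
have := rU a (ltW a0) ar 1 ler01 (lexx 1).
rewrite scale1r scalerA -of_realM/= => /(_ feas).
by rewrite leNgt f0.
Unshelve. all: by end_near.
Qed.
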